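(* Let $G$ be a $4$-regular graph. Then $G$ has an orientation $\sigma$ such that $G^\sigma$ has optimum skew energy if and only if $G$ belongs to $\mathcal{F}$.
   Context: For a simple undirected graph $G$ on $n$ vertices $v_1,\dots,v_n$, an orientation $\sigma$ yields an oriented graph $G^\sigma$ with skew-adjacency matrix $S(G^\sigma)=[s_{ij}]$, where $s_{ij}=1$, $s_{ji}=-1$ if $\langle v_i,v_j\rangle$ is an arc and $s_{ij}=s_{ji}=0$ otherwise. The skew energy is the sum of the absolute values of the eigenvalues of $S(G^\sigma)$; $G^\sigma$ has optimum skew energy if this equals $n\sqrt{\Delta}$, $\Delta$ the maximum degree (equivalently $S(G^\sigma)^TS(G^\sigma)=\Delta I_n$). The paper's conclusion concerns (as throughout) connected graphs; $\mathcal{F}$ is the family consisting of the following graphs (up to isomorphism): $G_1$: vertices $u_1,\dots,u_4,v_1,\dots,v_4$; $\{u_1,\dots,u_4\}$ and $\{v_1,\dots,v_4\}$ each induce $K_4$, plus edges $u_iv_i$ ($K_4\square K_2$). $G_2$: the octahedron $K_{2,2,2}$. $G_3$: vertices $u,v,u_1,\dots,u_6,v_1,\dots,v_5,w$ with edges $uu_1,uu_2,uv_1,uv_2,vu_1,vu_2,vu_5,vu_6,u_1u_3,u_1u_4,u_2v_3,u_2v_4,v_1u_3,v_1v_3,v_1w,v_2u_4,v_2v_4,v_2w,u_3u_5,u_3v_5,u_4u_6,u_4v_5,v_3u_6,v_3v_5,v_4u_5,v_4v_5,wu_5,wu_6$. $Q_4$: the $4$-dimensional hypercube. $\mathcal{G}_i$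 ($i\ge1$): vertices $u,v,u_1,\dots,u_{2i+2},v_1,\dots,v_{2i+2}$; $u,v$ each adjacent to $u_1,u_2,v_1,v_2$; for $k=1,\dots,i$, each of $u_{2k-1},u_{2k}$ adjacent to each of $u_{2k+1},u_{2k+2}$ and each of $v_{2k-1},v_{2k}$ adjacent to each of $v_{2k+1},v_{2k+2}$; plus edges $u_{2i+1}v_{2i+2},v_{2i+2}u_{2i+2},u_{2i+2}v_{2i+1},v_{2i+1}u_{2i+1}$. $\mathcal{H}_j$ ($j\ge1$): vertices $u,v,u_1,\dots,u_{2j+2},v_1,\dots,v_{2j}$; $u,v$ each adjacent to $u_1,u_2,v_1,v_2$; for $k=1,\dots,j$, each of $u_{2k-1},u_{2k}$ adjacent to each of $u_{2k+1},u_{2k+2}$; for $k=1,\dots,j-1$, each of $v_{2k-1},v_{2k}$ adjacent to each of $v_{2k+1},v_{2k+2}$; each of $v_{2j-1},v_{2j}$ adjacent to each of $u_{2j+1},u_{2j+2}$. *)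

(* Defs.v *)
From HB Require Import structures.
From mathcomp Require Import all_boot all_order all_algebra all_field.

Set Implicit Arguments.
Unset Strict Implicit.
Unset Printing Implicit Defensive.

Import Order.TTheory GRing.Theory Num.Theory.

(* A finite simple graph is a symmetric irreflexive relation on a finType. *)

Definition connected_graph (V : finType) (e : rel V) : Prop :=
  0 < #|V| /\ forall x y, connect e x y.

Definition degree (V : finType) (e : rel V) (x : V) : nat := #|[set y | e x y]|.

Definition regular (V : finType) (k : nat) (e : rel V) : Prop :=
  forall x, degree e x = k.

Definition max_degree (V : finType) (e : rel V) : nat := \max_x degree e x.

Definition isomorphic (V W : finType) (e : rel V) (e' : rel W) : Prop :=
  exists2 f : V -> W, bijective f & {mono f : x y / e x y >-> e' x y}.

(* [o x y] means that <x, y> is an arc. *)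
Definition orientation (V : finType) (e o : rel V) : Prop :=
  (forall x y, e x y = o x y || o y x) /\ (forall x y, ~~ (o x y && o y x)).

Definition skew_adjacency n (o : rel 'I_n) : 'M[algC]_n :=
  \matrix_(i, j) (if o i j then 1 else if o j i then -1 else 0)%R.

(* The roots of the characteristic polynomial, listed with multiplicity;
   algC is large enough since the matrices considered have integer entries. *)
Definition eigenvalues n (A : 'M[algC]_n) : seq algC :=
  sval (closed_field_poly_normal (char_poly A)).

Definition skew_energy n (o : rel 'I_n) : algC :=
  (\sum_(z <- eigenvalues (skew_adjacency o)) `|z|)%R.

Definition optimum_skew_energy n (e o : rel 'I_n) : Prop :=
  skew_energy o = (n%:R * sqrtC (max_degree e)%:R)%R.

Definition edge_graph n (s : seq (nat * nat)) : rel 'I_n :=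
  fun x y => ((x : nat, y : nat) \in s) || ((y : nat, x : nat) \in s).

(* All edges between a vertex of [s] and a vertex of [t]. *)
Definition biclique (s t : seq nat) : seq (nat * nat) := [seq (x, y) | x <- s, y <- t].

(* (false, k) is u_(k+1) and (true, k) is v_(k+1). *)
Definition G1 : rel (bool * 'I_4) :=
  fun x y => if x.1 == y.1 then x.2 != y.2 else x.2 == y.2.

Definition G2 : rel ('I_3 * 'I_2) := fun x y => x.1 != y.1.

(* u, v, u_1, ..., u_6, v_1, ..., v_5, w are numbered 0, ..., 13 in this order. *)
Definition G3_edges : seq (nat * nat) :=
  let u := 0 in let v := 1 in let w := 13 in
  let u_ k := k + 1 in let v_ k := k + 7 in
  [:: (u, u_ 1); (u, u_ 2); (u, v_ 1); (u, v_ 2);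
      (v, u_ 1); (v, u_ 2); (v, u_ 5); (v, u_ 6);
      (u_ 1, u_ 3); (u_ 1, u_ 4); (u_ 2, v_ 3); (u_ 2, v_ 4);
      (v_ 1, u_ 3); (v_ 1, v_ 3); (v_ 1, w);
      (v_ 2, u_ 4); (v_ 2, v_ 4); (v_ 2, w);
      (u_ 3, u_ 5); (u_ 3, v_ 5); (u_ 4, u_ 6); (u_ 4, v_ 5);
      (v_ 3, u_ 6); (v_ 3, v_ 5); (v_ 4, u_ 5); (v_ 4, v_ 5);
      (w, u_ 5); (w, u_ 6)].

Definition G3 : rel 'I_14 := edge_graph G3_edges.

Definition Q4 : rel {ffun 'I_4 -> bool} :=
  fun x y => #|[set i | x i != y i]| == 1.

(* u, v, u_1, ..., u_(2i+2), v_1, ..., v_(2i+2) are numbered 0, 1, 2, ... *)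
Definition Gfam_edges (i : nat) : seq (nat * nat) :=
  let u := 0 in let v := 1 in
  let u_ k := k + 1 in let v_ k := 2 * i + 2 + k + 1 in
  biclique [:: u; v] [:: u_ 1; u_ 2; v_ 1; v_ 2]
  ++ flatten [seq biclique [:: u_ (2 * k - 1); u_ (2 * k)]
                           [:: u_ (2 * k + 1); u_ (2 * k + 2)]
                  ++ biclique [:: v_ (2 * k - 1); v_ (2 * k)]
                              [:: v_ (2 * k + 1); v_ (2 * k + 2)]
             | k <- iota 1 i]
  ++ [:: (u_ (2 * i + 1), v_ (2 * i + 2)); (v_ (2 * i + 2), u_ (2 * i + 2));
         (u_ (2 * i + 2), v_ (2 * i + 1)); (v_ (2 * i + 1), u_ (2 * i + 1))].

Definition Gfam (i : nat) : rel 'I_(2 + (2 * i + 2) + (2 * i + 2)) :=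
  edge_graph (Gfam_edges i).
Arguments Gfam : clear implicits.

(* u, v, u_1, ..., u_(2j+2), v_1, ..., v_(2j) are numbered 0, 1, 2, ... *)
Definition Hfam_edges (j : nat) : seq (nat * nat) :=
  let u := 0 in let v := 1 in
  let u_ k := k + 1 in let v_ k := 2 * j + 2 + k + 1 in
  biclique [:: u; v] [:: u_ 1; u_ 2; v_ 1; v_ 2]
  ++ flatten [seq biclique [:: u_ (2 * k - 1); u_ (2 * k)]
                           [:: u_ (2 * k + 1); u_ (2 * k + 2)] | k <- iota 1 j]
  ++ flatten [seq biclique [:: v_ (2 * k - 1); v_ (2 * k)]
                           [:: v_ (2 * k + 1); v_ (2 * k + 2)] | k <- iota 1 j.-1]
  ++ biclique [:: v_ (2 * j - 1); v_ (2 * j)] [:: u_ (2 * j + 1); u_ (2 * j + 2)].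

Definition Hfam (j : nat) : rel 'I_(2 + (2 * j + 2) + 2 * j) :=
  edge_graph (Hfam_edges j).
Arguments Hfam : clear implicits.

Definition in_family (V : finType) (e : rel V) : Prop :=
  [\/ isomorphic e G1, isomorphic e G2, isomorphic e G3 | isomorphic e Q4]
  \/ (exists2 i, 0 < i & isomorphic e (Gfam i))
  \/ (exists2 j, 0 < j & isomorphic e (Hfam j)).

(* Main.v *)
Require Import Defs.
From mathcomp Require Import all_boot all_order all_algebra all_field.
From mathcomp Require Import spectral sesquilinear zify ring.

(* By the spectral theorem and the equality case of Cauchy-Schwarz, the skew
   energy of a 4-regular oriented graph is optimum iff S S^T = 4 I, that is, iff
   the rows of the skew-adjacency matrix S are pairwise orthogonal.  Hence
   distinct vertices have 0, 2 or 4 common neighbours.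

   If two vertices x, y have the same neighbours, orthogonality of the columns
   indexed by these neighbours pairs them up into vertices with the same
   neighbours; by connectedness the whole graph is then paired up, and the pairs
   form a cycle, so that the graph is a cycle with doubled vertices: K_{2,2,2},
   G_i or H_j, according to the length 3, 2i+3 or 2j+2 of the cycle.

   Otherwise distinct vertices have 0 or 2 common neighbours, which leaves
   finitely many graphs, found by an exhaustive breadth-first exploration: they
   have 8, 14 or 16 vertices and are isomorphic to K_4 [] K_2, G_3 or Q_4. *)

Set Implicit Arguments.
Unset Strict Implicit.
Unset Printing Implicit Defensive.

Import Order.TTheory GRing.Theory Num.Theory.

(** * Optimum skew energy as orthogonality *)

(** The condition S S^T = 4 I with integer entries and any vertex type, so that it travels along
    isomorphisms and can be checked by computation. *)
Definition signing (V : finType) (e : rel V) (s : V -> V -> int) : Prop :=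
  [/\ forall x y, s x y = (- s y x)%R, forall x y, `|s x y|%N = e x y
    & forall x y, (\sum_z s x z * s y z = 4 *+ (x == y))%R].

Definition signable (V : finType) (e : rel V) : Prop :=
  exists s : V -> V -> int, signing e s.

Section Spectral.
Local Open Scope ring_scope.
Local Open Scope sesquilinear_scope.

Lemma similar_char_poly (F : fieldType) n (P A B : 'M[F]_n) :
  P \in unitmx -> A = invmx P *m B *m P -> char_poly A = char_poly B.
Proof.
move=> Pu ->; rewrite /char_poly.
have Pu' : map_mx polyC P \in unitmx by rewrite map_unitmx.
have -> : char_poly_mx (invmx P *m B *m P) =
    invmx (map_mx polyC P) *m char_poly_mx B *m map_mx polyC P.
  rewrite /char_poly_mx !map_mxM map_invmx mulmxBr mulmxBl.
  by rewrite mul_mx_scalar -scalemxAl mulVmx // scalemx1.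
by rewrite !det_mulmx mulrAC -det_mulmx mulVmx // det1 mul1r.
Qed.

(** By the spectral theorem [A] is similar to a diagonal matrix, so both lists hold the roots of one
    monic polynomial. *)
Lemma eigenvalues_spectral n (A : 'M[algC]_n) : A \is normalmx ->
  perm_eq (eigenvalues A) [seq spectral_diag A 0 i | i : 'I_n].
Proof.
move=> /orthomx_spectralP Asp; rewrite /eigenvalues.
case: closed_field_poly_normal => r /=.
rewrite (monicP (char_poly_monic A)) scale1r => Er; apply: prod_XsubC_eq.
rewrite -Er {Er}.
rewrite [char_poly A](similar_char_poly (spectral_unit A) Asp).
rewrite /char_poly det_trig; last first.
  apply/is_trig_mxP=> i j ij; rewrite !mxE.
  by rewrite (_ : (i == j) = false) ?mulr0n ?subrr //; apply/eqP=> E; rewrite E ltnn in ij.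
rewrite big_image /=; apply: eq_bigr => i _.
by rewrite !mxE eqxx.
Qed.


Lemma normal_mul_adjoint n (A : 'M[algC]_n) : A \is normalmx ->
  A *m A ^t* = invmx (spectralmx A)
    *m diag_mx (\row_i `|spectral_diag A 0 i| ^+ 2) *m spectralmx A.
Proof.
move=> /orthomx_spectralP {1 2}->; set U := spectralmx A.
have Uu : U \is unitarymx := spectral_unitarymx A.
rewrite !trmx_mul !map_mxM !invmx_unitary // trmxCK !mulmxA.
rewrite -(mulmxA _ U) (unitarymxP Uu) mulmx1.
congr (_ *m _); rewrite -!mulmxA; congr (_ *m _).
rewrite tr_diag_mx map_diag_mx mulmx_diag; congr diag_mx.
by apply/rowP=> i; rewrite !mxE normCK.
Qed.

Lemma energy_spectral n (A : 'M[algC]_n) : A \is normalmx ->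
  \sum_(z <- eigenvalues A) `|z| = \sum_i `|spectral_diag A 0 i|.
Proof.
by move=> An; rewrite (perm_big _ (eigenvalues_spectral An)) big_image.
Qed.

(* Equality in the Cauchy-Schwarz bound of the energy by the Frobenius norm. *)
Lemma normal_energyP n (A : 'M[algC]_n) (d : algC) : A \is normalmx -> 0 <= d ->
  \tr (A *m A ^t* ) = n%:R * d ^+ 2 ->
  \sum_(z <- eigenvalues A) `|z| = n%:R * d <-> A *m A ^t* = (d ^+ 2)%:M.
Proof.
move=> An d0 trA; rewrite energy_spectral //; split=> [sumd | AA].
  have norm_d i : `|spectral_diag A 0 i| = d.
    (* The expansion is [n d^2 - 2 d (n d) + n d^2]: the squared moduli sum to the trace, the moduli
       to [n d]. *)
    have : \sum_i (`|spectral_diag A 0 i| - d) ^+ 2 = 0.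
      under eq_bigr do rewrite sqrrB -mulr_natr -mulrA.
      rewrite big_split /= sumrB -mulr_suml sumd sumr_const card_ord.
      move: trA; rewrite normal_mul_adjoint // mxtrace_mulC mulmxA.
      rewrite mulmxV ?spectral_unit // mul1mx mxtrace_diag.
      under eq_bigr do rewrite mxE.
      move=> ->; rewrite -mulr_natl; ring.
    move/eqP; rewrite psumr_eq0 => [/allP/(_ i)|j _].
      by rewrite mem_index_enum sqrf_eq0 subr_eq0 => /(_ isT)/eqP.
    by rewrite real_exprn_even_ge0 // rpredB ?normr_real ?ger0_real.
  rewrite normal_mul_adjoint //.
  have -> : diag_mx (\row_i `|spectral_diag A 0 i| ^+ 2) = (d ^+ 2)%:M.
    by rewrite -diag_const_mx; congr diag_mx; apply/rowP=> i; rewrite !mxE norm_d.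
  by rewrite mul_mx_scalar -scalemxAl mulVmx ?spectral_unit // scalemx1.
(* Conjugation fixes a scalar matrix, so each squared modulus equals [d ^+ 2]. *)
have norm_d i : `|spectral_diag A 0 i| = d.
  apply/eqP; rewrite -(@eqrXn2 _ 2) //.
  have := normal_mul_adjoint An; rewrite AA => /(congr1 (mulmx (spectralmx A))).
  rewrite !mulmxA mulmxV ?spectral_unit // mul1mx.
  rewrite mul_mx_scalar => /(congr1 (mulmx^~ (invmx (spectralmx A)))).
  rewrite /= -scalemxAl mulmxK ?spectral_unit // mulmxV ?spectral_unit //.
  rewrite scalemx1 => /matrixP/(_ i i); rewrite !mxE eqxx !mulr1n => ->.
  by rewrite eqxx.
by under eq_bigr do rewrite norm_d; rewrite sumr_const card_ord mulr_natl.
Qed.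

Definition arc_sign (V : Type) (o : rel V) (x y : V) : int :=
  if o x y then 1 else if o y x then -1 else 0.

Lemma orientation_arc_sign (V : finType) (e o : rel V) : orientation e o ->
  (forall x y, arc_sign o x y = - arc_sign o y x)
  /\ (forall x y, `|arc_sign o x y|%N = e x y).
Proof.
move=> [eE oA]; split=> x y; have := oA x y; rewrite ?eE /arc_sign;
  by case: (o x y); case: (o y x).
Qed.

Lemma sign_orientation (V : finType) (e : rel V) (s : V -> V -> int) :
  (forall x y, s x y = - s y x) -> (forall x y, `|s x y|%N = e x y) ->
  let o := fun x y => s x y == 1 in orientation e o /\ arc_sign o =2 s.
Proof.
move=> sN sE o; split; [split|] => x y; rewrite ?/arc_sign /o (sN y x);
  by have := sE x y; case: (e x y) => /= sxy; do ?case: eqP => ? //=; lia.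
Qed.

Lemma sign_sqr (V : finType) (e : rel V) (s : V -> V -> int) x :
  (forall x y, `|s x y|%N = e x y) -> \sum_y s x y * s x y = (degree e x)%:Z.
Proof.
move=> sE; rewrite /degree -sum1dep_card -natz natr_sum [RHS]big_mkcond /=.
by apply: eq_bigr => y _; have := sE x y; case: (e x y) => /= ?; nia.
Qed.

(** The matrix is real and skew-symmetric: its adjoint is its opposite, whence normality. *)
Lemma gram_skew_adjacency n (o : rel 'I_n) :
  (forall x y, arc_sign o x y = - arc_sign o y x) ->
  let A := skew_adjacency o in
  A \is normalmx /\ A *m A ^t* =
    \matrix_(i, j) (\sum_k arc_sign o i k * arc_sign o j k)%:~R.
Proof.
move=> oN A.
have AE i j : A i j = (arc_sign o i j)%:~R.
  by rewrite mxE /arc_sign; case: (o i j); case: (o j i); rewrite ?mulrN1z.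
have At : A ^t* = - A.
  apply/matrixP=> i j; rewrite [LHS]mxE [A^T i j]mxE [RHS]mxE !AE oN.
  by rewrite rmorph_int mulrNz.
split; first by apply/normalmxP; rewrite At mulmxN mulNmx.
apply/matrixP=> i j; rewrite !mxE rmorph_sum; apply: eq_bigr => k _ /=.
by rewrite [(A ^t* ) k j]mxE [A^T k j]mxE !AE rmorph_int rmorphM.
Qed.

Lemma optimum_signable n (e : rel 'I_n) : regular 4 e ->
  (exists o, orientation e o /\ optimum_skew_energy e o) <-> signable e.
Proof.
move=> e4.
have opt o : orientation e o -> optimum_skew_energy e o <->
    forall x y, \sum_z arc_sign o x z * arc_sign o y z = 4 *+ (x == y).
  move=> eo; have [oN oE] := orientation_arc_sign eo.
  have [An AA] := gram_skew_adjacency oN.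
  have -> : optimum_skew_energy e o <->
      \sum_(z <- eigenvalues (skew_adjacency o)) `|z| = n%:R * 2.
    rewrite /optimum_skew_energy /skew_energy; case: n e e4 o eo oN oE An AA => [|n] e e4 *.
      (* Without vertices the maximum degree is 0 instead of 4, but the factor [n%:R] vanishes. *)
      by rewrite !mul0r.
    suff -> : max_degree e = 4%N by rewrite (natrX _ 2 2) sqrCK // ler0n.
    apply/eqP; rewrite eqn_leq; apply/andP; split.
      by apply/bigmax_leqP=> x _; rewrite e4.
    by rewrite -(e4 ord0) /max_degree; apply: leq_bigmax.
  rewrite (normal_energyP An) ?ler0n //.
    rewrite AA; split=> [/matrixP E x y | E].
      by have := E x y; rewrite !mxE -natrX => Exy; apply/eqP;
        rewrite -(eqr_int algC) Exy rmorphMn.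
    by apply/matrixP=> x y; rewrite !mxE E rmorphMn -natrX.
  rewrite AA /mxtrace mulr_natl -natrX -[in RHS](card_ord n) -sumr_const.
  by apply: eq_bigr => x _; rewrite mxE (sign_sqr _ oE) e4.
split=> [[o [eo /(opt _ eo) oo]] | [s [sN sE ss]]].
  by have [oN oE] := orientation_arc_sign eo; exists (arc_sign o).
have [eo os] := sign_orientation sN sE; exists (fun x y => s x y == 1).
split=> //; apply/opt => // x y; rewrite -ss.
by apply: eq_bigr => z _; rewrite !os.
Qed.
End Spectral.

(** * Signings of the graphs of the family *)

Lemma isomorphic_sym (V W : finType) (e : rel V) (e' : rel W) :
  isomorphic e e' -> isomorphic e' e.
Proof.
case=> f [g fK gK] fe; exists g; first by exists f.
by move=> x y; rewrite -fe !gK.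
Qed.

Lemma isomorphic_trans (V W X : finType) (e : rel V) (e' : rel W) (e'' : rel X) :
  isomorphic e e' -> isomorphic e' e'' -> isomorphic e e''.
Proof.
case=> f bf fe [g bg ge]; exists (g \o f); first exact: bij_comp.
by move=> x y /=; rewrite ge fe.
Qed.

Lemma inj_isomorphic (V W : finType) (e : rel V) (e' : rel W) (f : V -> W) :
  injective f -> #|V| = #|W| -> {mono f : x y / e x y >-> e' x y} ->
  isomorphic e e'.
Proof. by move=> fi VW fe; exists f => //; apply: inj_card_bij; rewrite ?VW. Qed.

Lemma signable_isomorphic (V W : finType) (e : rel V) (e' : rel W) :
  isomorphic e e' -> signable e' -> signable e.
Proof.
case=> f bf fe [s [sN sE ss]]; exists (fun x y => s (f x) (f y)).
split=> x y; [exact: sN | by rewrite sE fe |].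
rewrite -(bij_eq bf) -ss [RHS](reindex f) //=.
exact: onW_bij.
Qed.

(** * Certificates decided by computation on natural numbers *)

Definition rel_on k (r : rel nat) : rel 'I_k := fun x y => r x y.

Definition all_pairs (k : nat) (p : rel nat) : bool :=
  all (fun i => all (p i) (iota 0 k)) (iota 0 k).

Lemma all_pairsP k (p : rel nat) : all_pairs k p -> forall i j : 'I_k, p i j.
Proof.
have mem_k (i : 'I_k) : nat_of_ord i \in iota 0 k by rewrite mem_iota /=.
by move=> /allP kp i j; apply: (allP (kp _ (mem_k i))).
Qed.

Definition out_rel (t : seq (seq nat)) : rel nat := fun i j => j \in nth [::] t i.

Definition signing_table k (r : rel nat) (t : seq (seq nat)) : bool :=
  let s := arc_sign (out_rel t) in
  all_pairs k (fun i j =>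
    [&& r i j == out_rel t i j || out_rel t j i,
        ~~ (out_rel t i j && out_rel t j i) &
        foldr +%R 0%R [seq (s i z * s j z)%R | z <- iota 0 k] == (4 *+ (i == j))%R]).

Lemma signing_tableP k r t : signing_table k r t -> signable (@rel_on k r).
Proof.
move=> /all_pairsP kt; exists (fun x y : 'I_k => arc_sign (out_rel t) x y).
have [|sN sE] := @orientation_arc_sign _ (@rel_on k r) (@rel_on k (out_rel t)).
  by split=> x y; have /and3P[/eqP //] := kt x y.
split=> // x y; have /and3P[_ _ /eqP] := kt x y.
rewrite foldrE big_map -[in iota _ _](subn0 k) -/(index_iota 0 k) big_mkord.
by [].
Qed.

(** The entry of index [i] in [q] is the image of vertex [i]. *)
Definition iso_table k (r r' : rel nat) (q : seq nat) : bool :=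
  [&& size q == k, uniq q, all (gtn k) q &
      all_pairs k (fun i j => r' (nth 0 q i) (nth 0 q j) == r i j)].

Lemma iso_tableP k r r' q : iso_table k r r' q ->
  isomorphic (@rel_on k r) (@rel_on k r').
Proof.
move=> /and4P[/eqP sq uq /allP qk /all_pairsP rq].
have qlt (i : 'I_k) : nth 0 q i < k by apply/qk/mem_nth; rewrite sq.
apply: (@inj_isomorphic _ _ _ _ (fun i => Ordinal (qlt i))) => //.
  by move=> i j [/eqP]; rewrite nth_uniq ?sq // => /eqP/val_inj.
by move=> i j; apply/eqP/rq.
Qed.

(** * Cycles with doubled vertices *)

Definition cycle_blowup m : rel ('I_m * bool) :=
  fun x y => (y.1 == ordS x.1) || (x.1 == ordS y.1).

(** For [m = 2] successor and predecessor coincide; from 3 on each edge of the cycle has a single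
    direction. *)
Lemma ordS_asym m (i j : 'I_m) : 2 < m -> ~~ ((j == ordS i) && (i == ordS j)).
Proof.
move=> m2; apply/negP => /andP[/eqP -> /eqP /(congr1 (@nat_of_ord m)) /=]; have := ltn_ord i.
case: m m2 i {j} => [|[|[|m]]] // _ i; move: (nat_of_ord i) => {}i.
rewrite leq_eqVlt => /orP[/eqP Ei | lt_i]; first by rewrite Ei modnn modn_small // => ?; lia.
rewrite [i.+1 %% _]modn_small //; move: lt_i.
rewrite leq_eqVlt => /orP[/eqP Ei | lt_i]; first by rewrite Ei modnn => ?; lia.
by rewrite modn_small // => ?; lia.
Qed.

(** The sign depends only on the Boolean of the endpoint that comes second along the cycle. Twins
    have equal rows over the next pair and opposite rows over the previous one, hence are
    orthogonal; rows of different positions cancel within each common pair. *)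
Lemma signable_cycle_blowup m : 2 < m -> signable (@cycle_blowup m).
Proof.
move=> m2.
pose sg (b : bool) : int := ((-1) ^+ b)%R.
pose s (x y : 'I_m * bool) : int :=
  ((y.1 == ordS x.1)%:R * sg y.2 - (x.1 == ordS y.1)%:R * sg x.2)%R.
exists s; split=> [x y | x y |].
- by rewrite /s opprB.
- rewrite /s /cycle_blowup; have := ordS_asym x.1 y.1 m2.
  by do 2!case: eqP => //= _; case: x.2; case: y.2.
move=> [k b] [l c]; rewrite /s /=.
rewrite -(pair_bigA _ (fun j d => ((j == ordS k)%:R * sg d - (k == ordS j)%:R * sg b) *
  ((j == ordS l)%:R * sg d - (l == ordS j)%:R * sg c)))%R /=.
under eq_bigr => j _.
  rewrite big_bool /=.
  (* Mixed products disappear because [sg true + sg false = 0]. *)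
  have -> : (((j == ordS k)%:R * sg true - (k == ordS j)%:R * sg b) *
      ((j == ordS l)%:R * sg true - (l == ordS j)%:R * sg c) +
     ((j == ordS k)%:R * sg false - (k == ordS j)%:R * sg b) *
      ((j == ordS l)%:R * sg false - (l == ordS j)%:R * sg c) =
    2 * ((j == ordS k)%:R * (j == ordS l)%:R)
    + (2 * sg b * sg c) * ((k == ordS j)%:R * (l == ordS j)%:R) :> int)%R.
    by rewrite /sg expr0 expr1; ring.
  over.
rewrite big_split -!mulr_sumr /=.
have -> : (\sum_(j : 'I_m) (j == ordS k)%:R * (j == ordS l)%:R = (k == l)%:R :> int)%R.
  rewrite (bigD1 (ordS k)) //= big1 => [|j /negPf ->]; last by rewrite mul0r.
  by rewrite eqxx mul1r addr0 (inj_eq (can_inj (@ordSK m))).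
have -> : (\sum_(j : 'I_m) (k == ordS j)%:R * (l == ordS j)%:R = (k == l)%:R :> int)%R.
  rewrite (bigD1 (ord_pred k)) //= big1 => [|j].
    by rewrite ord_predK eqxx mul1r addr0 eq_sym.
  by rewrite -(inj_eq (can_inj (@ordSK m))) ord_predK eq_sym => /negPf ->; rewrite mul0r.
rewrite xpair_eqE; case: eqP => _ /=; last by rewrite !mulr0 mulr0n.
by case: b; case: c.
Qed.

(** * The three sporadic graphs *)

Definition K4K2_rel : rel nat := fun i j =>
  if i %/ 4 == j %/ 4 then i %% 4 != j %% 4 else i %% 4 == j %% 4.

Definition G3_rel : rel nat := fun i j =>
  ((i, j) \in G3_edges) || ((j, i) \in G3_edges).

(** Vertices of the hypercube are numbered by binary expansion. *)
Definition bit k i := odd (i %/ 2 ^ k).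

Definition Q4_rel : rel nat := fun i j =>
  count (fun k => bit k i != bit k j) (iota 0 4) == 1.

Lemma G1_iso : isomorphic G1 (@rel_on 8 K4K2_rel).
Proof.
have lt8 (x : bool * 'I_4) : x.1 * 4 + x.2 < 8 by case: x => [] [] [i] /=; lia.
apply: (@inj_isomorphic _ _ _ _ (fun x => Ordinal (lt8 x))).
- move=> [b i] [c j] [] /= E; have := ltn_ord i; have := ltn_ord j => ltj lti.
  have bc : b = c by case: b c E => [] [] //=; lia.
  by rewrite bc in E *; congr (_, _); apply: ord_inj; move/addnI: E.
- by rewrite card_prod card_bool !card_ord.
move=> [b i] [c j]; rewrite /rel_on /K4K2_rel /G1 /= !divnMDl // !modnMDl.
rewrite !divn_small ?ltn_ord // !modn_small ?ltn_ord // !addn0.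
by case: b; case: c.
Qed.

Lemma Q4_iso : isomorphic Q4 (@rel_on 16 Q4_rel).
Proof.
pose F (x : {ffun 'I_4 -> bool}) :=
  x (inord 0) + 2 * x (inord 1) + 4 * x (inord 2) + 8 * x (inord 3).
have lt16 x : F x < 16.
  by rewrite /F; case: (x _); case: (x _); case: (x _); case: (x _).
have bitF x k : k < 4 -> bit k (F x) = x (inord k).
  by case: k => [|[|[|[|]]]] // _; rewrite /bit /F;
    case: (x (inord 0)); case: (x (inord 1)); case: (x (inord 2)); case: (x (inord 3)).
apply: (@inj_isomorphic _ _ _ _ (fun x => Ordinal (lt16 x))).
- move=> x y [Fxy]; apply/ffunP => i; rewrite -(inord_val i).
  by rewrite -!bitF ?Fxy.
- by rewrite card_ffun card_bool !card_ord.
move=> x y; rewrite /rel_on /Q4_rel /Q4 -sum1dep_card.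
rewrite (eq_bigl (fun i : 'I_4 => bit i (F x) != bit i (F y))); last first.
  by move=> i; rewrite !bitF // inord_val.
rewrite -(big_mkord (fun i => bit i (F x) != bit i (F y)) (fun=> 1)).
by rewrite sum1_count.
Qed.

(** Row [i] of each of the three tables lists the out-neighbours of [i] in an optimum orientation,
    which [signing_table] verifies. *)
Definition K4K2_signs : seq (seq nat) :=
  [:: [:: 1; 2; 3; 4]; [:: 2; 5]; [:: 3; 6]; [:: 1; 7]; [::]; [:: 4; 7];
      [:: 4; 5]; [:: 4; 6]].

Definition G3_signs : seq (seq nat) :=
  [:: [:: 2; 3; 8; 9]; [:: 2; 6; 7]; [:: 4; 5]; [:: 1; 10; 11]; [:: 6; 8; 12];
      [:: 7; 9]; [:: 11; 13]; [:: 10]; [::]; [:: 13]; [:: 8]; [:: 9; 12];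
      [:: 5; 10]; [:: 7; 8]].

Definition Q4_signs : seq (seq nat) :=
  [:: [:: 1; 2; 4; 8]; [:: 3; 5; 9]; [:: 6; 10]; [:: 2; 7; 11]; [:: 12];
      [:: 4; 13]; [:: 4; 7; 14]; [:: 5; 15]; [::]; [:: 8]; [:: 8; 11]; [:: 9];
      [:: 8; 13; 14]; [:: 9; 15]; [:: 10]; [:: 11; 14]].

Lemma signable_G1 : signable G1.
Proof.
by apply: signable_isomorphic G1_iso _; apply: (@signing_tableP _ _ K4K2_signs); vm_compute.
Qed.

Lemma signable_G3 : signable G3.
Proof. by apply: (@signing_tableP 14 G3_rel G3_signs); vm_compute. Qed.

Lemma signable_Q4 : signable Q4.
Proof.
by apply: signable_isomorphic Q4_iso _; apply: (@signing_tableP _ _ Q4_signs); vm_compute.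
Qed.

(** * The infinite families and the octahedron as doubled cycles *)

Lemma mem_biclique (s t : seq nat) x y :
  ((x, y) \in biclique s t) = (x \in s) && (y \in t).
Proof.
apply/allpairsP/andP => [[[a b] [? ?] [-> ->]] // | [xs yt]].
by exists (x, y).
Qed.

Lemma mem_flatten_iota (T : eqType) (g : nat -> seq T) n p :
  reflect (exists k, 1 <= k <= n /\ p \in g k)
          (p \in flatten [seq g k | k <- iota 1 n]).
Proof.
apply: (iffP flatten_mapP) => [[k kn pk] | [k [kn pk]]]; exists k => //.
  by rewrite mem_iota in kn; split=> //; lia.
by rewrite mem_iota; lia.
Qed.

Lemma eq_ordS m (i j : 'I_m) :
  (j == ordS i) = (j == i.+1 :> nat) || (i.+1 == m) && (j == 0 :> nat).
Proof.
rewrite -val_eqE /=; have := ltn_ord i; have := ltn_ord j.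
rewrite [i < m]leq_eqVlt => ltj /orP[/eqP im | ltS].
  by rewrite im modnn eqxx; apply/idP/idP; lia.
by rewrite modn_small //; apply/idP/idP; lia.
Qed.

(* The two sides of the cycle of pairs are numbered one after the other, both
   starting next to the pair 0; [M] is the last pair of the first side. *)
Definition cycle_position (M m k : nat) := if k <= M then k else m + M - k.

(** For indices below [m], the edges of the cycle 0, 1, ..., M, m-1, m-2, ..., M+1, 0, each in one
    direction. *)
Definition two_paths M m p q :=
  [|| (p == 0) && ((q == 1) || (q == M.+1)), [&& 0 < p, p != M & q == p.+1] |
      (p == M) && (q.+1 == m)].

Lemma two_paths_cycle M m p q : 0 < M -> M.+1 < m -> p < m -> q < m ->
  let f := cycle_position M m in
  two_paths M m p q || two_paths M m q p =
    [|| f q == (f p).+1, ((f p).+1 == m) && (f q == 0),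
        f p == (f q).+1 | ((f q).+1 == m) && (f p == 0)].
Proof.
rewrite /two_paths /cycle_position => M0 Mm pm qm /=.
case: (leqP p M) => pM; case: (leqP q M) => qM.
by apply/idP/idP; lia.
by apply/idP/idP; lia.
by apply/idP/idP; lia.
by apply/idP/idP; lia.
Qed.

(** The left-hand form is that of the edge lists; for [p = m.-1] the right-hand one would require
    [q = m], which the bound on [q] excludes. *)
Lemma middle_edges M m p q : q < m ->
  [&& 0 < p < M & q == p.+1] || [&& M < p < m.-1 & q == p.+1] =
  [&& 0 < p, p != M & q == p.+1].
Proof.
case: (eqVneq q p.+1) => [-> | _] ltq; rewrite ?andbF // !andbT.
by apply/idP/idP; lia.
Qed.

Lemma two_pathsE M m p q : q < m -> two_paths M m p q =
  [|| (p == 0) && ((q == 1) || (q == M.+1)),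
      [&& 0 < p < M & q == p.+1] || [&& M < p < m.-1 & q == p.+1] |
      (p == M) && (q == m.-1)].
Proof.
move=> ltq; rewrite middle_edges // /two_paths; congr [|| _, _ | _ && _].
by case: m ltq.
Qed.

(** Sets apart the edges closing the cycle: their listed directions vary, so only both directions
    together can be compared. *)
Lemma orb3ACA a b c a' b' c' :
  [|| a, b | c] || [|| a', b' | c'] = [|| a, b, a' | b'] || (c || c').
Proof. by case: a b c a' b' => [] [] [] [] []. Qed.

(** Vertex [x] lies in the pair [x %/ 2], and its parity distinguishes it from its twin. *)
Lemma two_paths_iso M m N (e : rel 'I_N) : N = 2 * m -> 0 < M -> M.+1 < m ->
  (forall x y : 'I_N, e x y =
     two_paths M m (x %/ 2) (y %/ 2) || two_paths M m (y %/ 2) (x %/ 2)) ->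
  isomorphic e (@cycle_blowup m).
Proof.
move=> Nm M0 Mm eE.
have lt2 (x : 'I_N) : x %/ 2 < m by have := ltn_ord x; lia.
have lt_pos (x : 'I_N) : cycle_position M m (x %/ 2) < m.
  by have := lt2 x; rewrite /cycle_position; case: ifP; lia.
apply: (@inj_isomorphic _ _ _ _ (fun x => (Ordinal (lt_pos x), odd x))).
- move=> x y [] /eqP xy o_xy; apply: ord_inj; have := ltn_ord x; have := ltn_ord y.
  have : x %/ 2 = y %/ 2.
    move: xy (lt2 x) (lt2 y); rewrite /cycle_position.
    by do 2!case: ifP; lia.
  by move=> xy2; rewrite (divn_eq x 2) (divn_eq y 2) !modn2 o_xy xy2.
- by rewrite card_prod card_bool !card_ord; lia.
by move=> x y; rewrite /cycle_blowup !eq_ordS /= eE two_paths_cycle // -!orbA.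
Qed.

Lemma mem_pair k x a b : a = 2 * k -> b = (2 * k).+1 ->
  (x \in [:: a; b]) = (x %/ 2 == k).
Proof. by rewrite !inE => -> ->; apply/idP/idP; lia. Qed.

Lemma mem_two_pairs k l x a b c d : a = 2 * k -> b = (2 * k).+1 ->
  c = 2 * l -> d = (2 * l).+1 ->
  (x \in [:: a; b; c; d]) = (x %/ 2 == k) || (x %/ 2 == l).
Proof. by rewrite !inE => -> -> -> ->; apply/idP/idP; lia. Qed.

Lemma Gfam_iso i : isomorphic (Gfam i) (@cycle_blowup (2 * i + 3)).
Proof.
(* Pair 0 consists of u and v, pairs 1 to [i.+1] of the u_k, and pairs [i.+2] to [2 * i + 2] of the
   v_k. *)
apply: (@two_paths_iso i.+1); [lia | by [] | lia | move=> x y].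
have ltx : x %/ 2 < 2 * i + 3 by have := ltn_ord x; lia.
have lty : y %/ 2 < 2 * i + 3 by have := ltn_ord y; lia.
have edgesE a b : ((a, b) \in Gfam_edges i) =
  [|| (a %/ 2 == 0) && ((b %/ 2 == 1) || (b %/ 2 == i.+2)),
      [&& 0 < a %/ 2 < i.+1 & b %/ 2 == (a %/ 2).+1]
      || [&& i.+1 < a %/ 2 < (2 * i + 3).-1 & b %/ 2 == (a %/ 2).+1] |
      (a, b) \in [:: (2 * i + 2, 4 * i + 5); (4 * i + 5, 2 * i + 3);
                     (2 * i + 3, 4 * i + 4); (4 * i + 4, 2 * i + 2)]].
  rewrite /Gfam_edges; cbv zeta; rewrite mem_cat mem_biclique mem_cat.
  congr [|| _, _ | _].
  - by rewrite (@mem_pair 0) // (@mem_two_pairs 1 i.+2) //; lia.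
  - apply/mem_flatten_iota/idP => [[k [kn]] | ].
      rewrite mem_cat !mem_biclique (@mem_pair k) 1?(@mem_pair k.+1); try lia.
      by rewrite (@mem_pair (i.+1 + k)) 1?(@mem_pair (i.+2 + k)); lia.
    case/orP=> /andP[kn /eqP Eb].
      exists (a %/ 2); split=> //; rewrite mem_cat !mem_biclique.
      by rewrite (@mem_pair (a %/ 2)) 1?(@mem_pair (a %/ 2).+1) ?eqxx ?Eb ?eqxx; try lia.
    exists (a %/ 2 - i.+1); split; first lia; rewrite mem_cat !mem_biclique orbC.
    by rewrite (@mem_pair (a %/ 2)) 1?(@mem_pair (a %/ 2).+1) ?eqxx ?Eb ?eqxx; try lia.
  by congr (_ \in [:: (_, _); (_, _); (_, _); (_, _)]); lia.
pose l a b := (a, b) \in [:: (2 * i + 2, 4 * i + 5); (4 * i + 5, 2 * i + 3);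
                             (2 * i + 3, 4 * i + 4); (4 * i + 4, 2 * i + 2)].
(* The four closing edges form a 4-cycle: up to direction, these are all the edges between the last
   pairs of the two sides. *)
have lE a b : l a b || l b a =
    (a %/ 2 == i.+1) && (b %/ 2 == 2 * i + 2)
    || (b %/ 2 == i.+1) && (a %/ 2 == 2 * i + 2).
  have first_pair c : (c %/ 2 == i.+1) = (c == 2 * i + 2) || (c == 2 * i + 3).
    by rewrite -(@mem_pair i.+1 c (2 * i + 2) (2 * i + 3)) ?inE //; lia.
  have second_pair c : (c %/ 2 == 2 * i + 2) = (c == 4 * i + 4) || (c == 4 * i + 5).
    by rewrite -(@mem_pair (2 * i + 2) c (4 * i + 4) (4 * i + 5)) ?inE //; lia.
  rewrite !first_pair !second_pair /l !inE !xpair_eqE.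
  by do 4![case: (a == _)]; do 4![case: (b == _)].
rewrite /Gfam /edge_graph !edgesE -/(l x y) -/(l y x) orb3ACA lE.
rewrite !two_pathsE //.
by rewrite orb3ACA; congr (_ || (_ && _ || _ && _)); congr (_ == _); lia.
Qed.

Lemma Hfam_iso j : 0 < j -> isomorphic (Hfam j) (@cycle_blowup (2 * j + 2)).
Proof.
(* Here the first side has one pair more than the second, and the closing edges are listed from the
   second side to the first. *)
move=> j0; apply: (@two_paths_iso j.+1); [lia | by [] | lia | move=> x y].
have ltx : x %/ 2 < 2 * j + 2 by have := ltn_ord x; lia.
have lty : y %/ 2 < 2 * j + 2 by have := ltn_ord y; lia.
have edgesE a b : ((a, b) \in Hfam_edges j) =
  [|| (a %/ 2 == 0) && ((b %/ 2 == 1) || (b %/ 2 == j.+2)),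
      [&& 0 < a %/ 2 < j.+1 & b %/ 2 == (a %/ 2).+1]
      || [&& j.+1 < a %/ 2 < (2 * j + 2).-1 & b %/ 2 == (a %/ 2).+1] |
      (a %/ 2 == (2 * j + 2).-1) && (b %/ 2 == j.+1)].
  rewrite /Hfam_edges; cbv zeta; rewrite mem_cat mem_biclique mem_cat mem_cat mem_biclique.
  rewrite [in RHS]orbA -!orbA; congr [|| _, _, _ | _].
  - by rewrite (@mem_pair 0) // (@mem_two_pairs 1 j.+2) //; lia.
  - apply/mem_flatten_iota/idP => [[k [kn]] | /andP[kn /eqP Eb]].
      by rewrite mem_biclique (@mem_pair k) 1?(@mem_pair k.+1); lia.
    exists (a %/ 2); split=> //; rewrite mem_biclique.
    by rewrite (@mem_pair (a %/ 2)) 1?(@mem_pair (a %/ 2).+1) ?eqxx ?Eb ?eqxx; try lia.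
  - apply/mem_flatten_iota/idP => [[k [kn]] | /andP[kn /eqP Eb]].
      by rewrite mem_biclique (@mem_pair (j.+1 + k)) 1?(@mem_pair (j.+2 + k)); lia.
    exists (a %/ 2 - j.+1); split; first lia; rewrite mem_biclique.
    by rewrite (@mem_pair (a %/ 2)) 1?(@mem_pair (a %/ 2).+1) ?eqxx ?Eb ?eqxx; try lia.
  by rewrite (@mem_pair (2 * j + 1)) 1?(@mem_pair j.+1); lia.
rewrite /Hfam /edge_graph !edgesE orb3ACA.
rewrite !two_pathsE //.
by rewrite orb3ACA; congr (_ || _); rewrite orbC; congr (_ || _); rewrite andbC.
Qed.

Lemma G2_iso : isomorphic G2 (@cycle_blowup 3).
Proof.
apply: (@inj_isomorphic _ _ _ _ (fun x : 'I_3 * 'I_2 => (x.1, x.2 == ord0))).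
- move=> [i b] [j c] [-> /= bc]; congr (_, _); apply: val_inj => /=.
  by case: b c bc => [] [|[|b]] // ? [[|[|c]]].
- by rewrite !card_prod card_bool !card_ord.
move=> [[i lti] b] [[j ltj] c]; rewrite /cycle_blowup /G2 /= -!val_eqE /=.
by case: i j lti ltj => [|[|[|]]] [|[|[|]]].
Qed.

Lemma in_family_cycle_blowup (V : finType) (e : rel V) m : 2 < m ->
  isomorphic e (@cycle_blowup m) -> in_family e.
Proof.
move=> m2 em; case: (eqVneq m 3) => [m3 | m3].
  rewrite m3 in em; left; constructor 2.
  exact: isomorphic_trans em (isomorphic_sym G2_iso).
have [[i Em] | [i Em]] : (exists i, m = 2 * i + 3) \/ (exists i, m = 2 * i + 2).
(* The index is [(m./2).-1] for both parities; excluding [m = 3] makes it positive. *)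
- by have := odd_double_half m; case: (odd m) => E; [left | right];
    exists (m./2).-1; lia.
- right; left; exists i; first lia.
  by rewrite Em in em; exact: isomorphic_trans em (isomorphic_sym (Gfam_iso i)).
right; right; have i0 : 0 < i by lia.
exists i => //; rewrite Em in em.
exact: isomorphic_trans em (isomorphic_sym (Hfam_iso i0)).
Qed.

Lemma signable_in_family (V : finType) (e : rel V) : in_family e -> signable e.
Proof.
case=> [[] eG | [[i i0 eG] | [j j0 eH]]]; first [apply: (signable_isomorphic eG)
  | apply: (signable_isomorphic eH)].
- exact: signable_G1.
- exact: signable_isomorphic G2_iso (signable_cycle_blowup _).
- exact: signable_G3.
- exact: signable_Q4.
- by apply: signable_isomorphic (Gfam_iso i) (signable_cycle_blowup _); lia.
by apply: signable_isomorphic (Hfam_iso j0) (signable_cycle_blowup _); lia.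
Qed.

(** * Graphs without vertices having the same neighbours *)

(* Unlike [has], this stops at the first success under call-by-value. *)
Fixpoint lazy_has (T : Type) (p : pred T) (s : seq T) : bool :=
  if s is x :: s' then if p x then true else lazy_has p s' else false.

Lemma lazy_hasE (T : Type) (p : pred T) s : lazy_has p s = has p s.
Proof. by elim: s => //= x s ->; case: (p x). Qed.

(** Backtracking on the images [q] of the first vertices. The final [iso_table] rechecks the whole
    map, so soundness does not rest on the pruning. *)
Fixpoint iso_search (k : nat) (r r' : rel nat) (fuel : nat) (q : seq nat) : bool :=
  if fuel is fuel'.+1 then
    lazy_has (fun c =>
      if all (fun j => r (size q) j == r' c (nth 0 q j)) (iota 0 (size q))
      then iso_search k r r' fuel' (rcons q c) else false) (iota 0 k)
  else iso_table k r r' q.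

Lemma iso_searchP k r r' fuel q : iso_search k r r' fuel q ->
  isomorphic (@rel_on k r) (@rel_on k r').
Proof.
elim: fuel q => [|fuel IH] q /=; first exact: iso_tableP.
by rewrite lazy_hasE => /hasP[c _]; case: ifP => // _ /IH.
Qed.

Fixpoint subseqs (T : Type) (s : seq T) : seq (seq T) :=
  if s is x :: s' then subseqs s' ++ [seq x :: t | t <- subseqs s'] else [:: [::]].

Lemma mem_subseqs (T : eqType) (a : pred T) (s : seq T) : filter a s \in subseqs s.
Proof.
elim: s => //= x s IH; rewrite mem_cat; case: (a x); last by rewrite IH.
by rewrite map_f ?orbT.
Qed.

(* Breadth-first exploration: the discovered vertices are numbered in order of
   discovery, [k] of them so far, and [rows] lists the neighbourhoods of the
   first ones.  The next row consists of its known neighbours, of a choice [t]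
   of discovered ones, and of new vertices.  The subtraction only truncates on
   rows that [admissible] rejects. *)
Definition next_rows (rows : seq (seq nat)) (k : nat) : seq (seq nat) :=
  let p := size rows in
  let known := [seq i <- iota 0 p | p \in nth [::] rows i] in
  [seq known ++ t ++ iota k (4 - size known - size t)
     | t <- subseqs (iota p.+1 (k - p.+1))].

Definition admissible (rows : seq (seq nat)) (row : seq nat) : bool :=
  (size row == 4) && all (fun r => count (mem r) row \in [:: 0; 2]) rows.

Definition known_graph (rows : seq (seq nat)) : bool :=
  let k := size rows in
  let search r := iso_search k (out_rel rows) r k [::] in
  if k == 8 then search K4K2_rel else
  if k == 14 then search G3_rel else
  if k == 16 then search Q4_rel else false.

(** Running out of fuel counts as failure: [true] certifies that each branch ends in a known graph
    or is cut by an inadmissible row. *)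
Fixpoint explore (fuel : nat) (rows : seq (seq nat)) (k : nat) : bool :=
  if size rows == k then known_graph rows else
  if fuel is fuel'.+1 then
    all (fun row => if admissible rows row
                    then explore fuel' (rcons rows row) (k + count (leq k) row)
                    else true)
        (next_rows rows k)
  else false.

(** The start is one discovered vertex without a row. Each vertex costs one unit of fuel, and the
    largest graph reached, [Q4], has 16 vertices. *)
Lemma explore_true : explore 16 [::] 1.
Proof. by vm_compute. Qed.

Definition common (V : finType) (e : rel V) (x y : V) : nat :=
  #|[set z | e x z && e y z]|.

Lemma connected_invariant (V : finType) (e : rel V) (x : V) (s : pred V) :
  (forall x y, connect e x y) -> s x -> (forall y z, s y -> e y z -> s z) ->
  forall y, s y.
Proof.
move=> cn sx cl y; have /connectP[p] := cn x y.
elim: p x sx {cn} => [|z p IH] x sx /=; first by move=> _ ->.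
by case/andP=> xz pz; apply: IH pz; apply: cl xz.
Qed.

(** * Soundness of the exploration *)

Section Exploration.
Variables (V : finType) (e : rel V).
Hypotheses (e_sym : symmetric e) (e_irr : irreflexive e)
  (e_conn : forall x y, connect e x y) (e4 : regular 4 e)
  (e_common : forall x y, x != y -> common e x y \in [:: 0; 2]).
Variable x0 : V.

Definition row_of (s : seq V) (x : V) : seq nat :=
  [seq j <- iota 0 (size s) | e x (nth x0 s j)].

(** Invariant: number [i] stands for [nth x0 s i]; the last clause keeps completed rows valid when
    [s] grows. *)
Definition explored (rows : seq (seq nat)) (s : seq V) : Prop :=
  [/\ uniq s, size rows <= size s,
      forall i, i < size rows -> nth [::] rows i = row_of s (nth x0 s i)
    & forall i v, i < size rows -> e (nth x0 s i) v -> v \in s].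

Lemma size_filter_nth (s : seq V) (a : pred V) : uniq s -> {subset a <= s} ->
  size [seq j <- iota 0 (size s) | a (nth x0 s j)] = #|[set v | a v]|.
Proof.
move=> us sub; rewrite cardsE -(size_map (nth x0 s)) -filter_map map_nth_iota0 // take_size.
rewrite -(card_uniqP _) ?filter_uniq //; apply: eq_card => v.
by rewrite mem_filter; case av: (a v) => //=; rewrite [LHS]sub.
Qed.

Lemma explored_closed rows s v : explored rows s -> 0 < size s ->
  size rows = size s -> v \in s.
Proof.
case=> us _ _ cl s0 rs; apply: (connected_invariant e_conn (mem_nth x0 s0)) => y z.
by move=> sy yz; apply: (cl (index y s)); rewrite ?rs ?index_mem // nth_index.
Qed.

Lemma explored_isomorphic rows s : explored rows s -> 0 < size s ->
  size rows = size s -> isomorphic e (@rel_on (size rows) (out_rel rows)).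
Proof.
move=> ex s0 rs; have sT v : v \in s by apply: explored_closed ex s0 rs.
have [us _ rE _] := ex; rewrite rs; apply: isomorphic_sym.
apply: (@inj_isomorphic _ _ _ _ (fun i => nth x0 s (nat_of_ord i))).
- by move=> i j /eqP; rewrite nth_uniq // => /eqP/ord_inj.
- by rewrite card_ord -(card_uniqP us); apply: eq_card => v; rewrite sT.
move=> i j; rewrite /rel_on /out_rel rE ?rs //.
by rewrite mem_filter mem_iota /= ltn_ord andbT.
Qed.

(** The graph itself follows one of the branches: the undiscovered neighbours of the next vertex are
    appended to [s], which fixes their numbers. *)
Lemma explored_step rows s : explored rows s -> size rows < size s ->
  exists row s', [/\ row \in next_rows rows (size s), admissible rows row,
    size s' = size s + count (leq (size s)) row & explored (rcons rows row) s'].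
Proof.
move=> [us rs rE cl] lt_rs; set p := size rows in lt_rs *.
pose x := nth x0 s p; pose new := [seq v <- enum V | e x v && (v \notin s)].
pose s' := s ++ new; exists (row_of s' x), s'.
have us' : uniq s'.
  rewrite cat_uniq us filter_uniq ?enum_uniq // andbT.
  by apply/hasPn => v; rewrite mem_filter => /andP[/andP[]].
have sub_x : {subset e x <= s'}.
  move=> v xv; rewrite mem_cat mem_filter mem_enum andbT.
  by case: (v \in s) => //=; rewrite andbT.
have s'E i : i < size s -> nth x0 s' i = nth x0 s i by move=> lt_i; rewrite nth_cat lt_i.
(* Appending vertices does not change earlier rows, since the neighbours of processed vertices
   already lie in [s]. *)
have rE' i : i < p -> nth [::] rows i = row_of s' (nth x0 s i).
  move=> lt_ip; rewrite rE // /row_of size_cat iotaD filter_cat add0n.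
  rewrite [X in _ ++ X](_ : _ = [::]) ?cats0.
    by apply: eq_in_filter => j; rewrite mem_iota => ?; rewrite s'E.
  rewrite -(filter_pred0 (iota (size s) (size new))); apply: eq_in_filter => j.
  rewrite mem_iota => /andP[le_j lt_j]; apply/negP => /(cl _ _ lt_ip).
  rewrite nth_cat ltnNge le_j /= => in_s.
  have : nth x0 new (j - size s) \in new by rewrite mem_nth // ltn_subLR.
  by rewrite mem_filter in_s andbF.
have size_row : size (row_of s' x) = 4 by rewrite size_filter_nth // [LHS]e4.
(* The three blocks of [next_rows]: processed neighbours, read from their rows by symmetry;
   discovered ones after [p], as [x] is not its own neighbour; new ones. *)
have rowE : row_of s' x =
    [seq i <- iota 0 p | p \in nth [::] rows i]
    ++ [seq j <- iota p.+1 (size s - p.+1) | e x (nth x0 s j)]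
    ++ iota (size s) (size new).
  rewrite /row_of size_cat iotaD filter_cat add0n catA; congr (_ ++ _); last first.
    apply/all_filterP/allP => j; rewrite mem_iota => /andP[le_j lt_j].
    rewrite nth_cat ltnNge le_j /=.
    have : nth x0 new (j - size s) \in new by rewrite mem_nth // ltn_subLR.
    by rewrite mem_filter => /andP[/andP[]].
  have -> : iota 0 (size s) = iota 0 p ++ p :: iota p.+1 (size s - p.+1).
    by rewrite -[p :: _]/(iota p (size s - p.+1).+1) -iotaD; congr iota; lia.
  rewrite filter_cat /= s'E // e_irr; congr (_ ++ _).
    apply: eq_in_filter => j; rewrite mem_iota => /= lt_j.
    by rewrite rE // mem_filter mem_iota /= lt_rs andbT s'E; [rewrite e_sym | lia].
  by apply: eq_in_filter => j; rewrite mem_iota => ?; rewrite s'E //; lia.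
split.
- apply/mapP; exists [seq j <- iota p.+1 (size s - p.+1) | e x (nth x0 s j)].
    exact: mem_subseqs.
  rewrite rowE; congr (_ ++ (_ ++ iota _ _)); move: size_row.
  by rewrite rowE !size_cat size_iota => <-; rewrite !addKn.
- rewrite /admissible size_row /=; apply/(all_nthP [::]) => i lt_i.
  (* Common numbers count common neighbours, because all neighbours of [x] lie in [s']. *)
  have -> : count (mem (nth [::] rows i)) (row_of s' x)
      = size [seq j <- iota 0 (size s') | e (nth x0 s i) (nth x0 s' j) && e x (nth x0 s' j)].
    rewrite rE' // -size_filter -filter_predI; congr size.
    by apply: eq_in_filter => j js /=; rewrite mem_filter js andbT.
  rewrite (size_filter_nth us' (a := fun v => e (nth x0 s i) v && e x v)).
    by apply: e_common; rewrite nth_uniq ?neq_ltn ?lt_i ?(ltn_trans lt_i).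
  by move=> v /andP[_ /sub_x].
- rewrite size_cat rowE !count_cat; congr (_ + _).
  rewrite (@eq_in_count _ _ pred0) ?count_pred0; last first.
    by move=> j; rewrite mem_filter mem_iota => /andP[_ ?] /=; apply/negbTE; lia.
  rewrite (@eq_in_count _ _ pred0) ?count_pred0; last first.
    by move=> j; rewrite mem_filter mem_iota => /andP[_ ?] /=; apply/negbTE; lia.
  rewrite (@eq_in_count _ _ predT) ?count_predT ?size_iota //.
  by move=> j; rewrite mem_iota => /andP[->].
split=> //.
- by rewrite size_rcons size_cat; lia.
- move=> i; rewrite size_rcons ltnS nth_rcons leq_eqVlt => /orP[/eqP -> | lt_i].
    by rewrite ltnn eqxx s'E.
  by rewrite lt_i rE' // s'E //; lia.
move=> i v; rewrite size_rcons ltnS leq_eqVlt => /orP[/eqP -> | lt_i].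
  by rewrite s'E // => /sub_x.
by rewrite s'E ?mem_cat; [move=> /(cl _ _ lt_i) -> | lia].
Qed.

Lemma known_graph_in_family rows :
  isomorphic e (@rel_on (size rows) (out_rel rows)) -> known_graph rows -> in_family e.
Proof.
move=> er kg; left; move: er kg; rewrite /known_graph; cbv zeta.
case: (eqVneq (size rows) 8) => [-> er /iso_searchP rG | _].
  by constructor 1; exact: isomorphic_trans er (isomorphic_trans rG (isomorphic_sym G1_iso)).
case: (eqVneq (size rows) 14) => [-> er /iso_searchP rG | _].
  by constructor 3; exact: isomorphic_trans er rG.
case: (eqVneq (size rows) 16) => [-> er /iso_searchP rG | //].
by constructor 4; exact: isomorphic_trans er (isomorphic_trans rG (isomorphic_sym Q4_iso)).
Qed.

(** Among the branches tested by [all] is the one that the graph follows, and its end identifies the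
    graph. *)
Lemma explore_in_family fuel rows s : explored rows s -> 0 < size s ->
  explore fuel rows (size s) -> in_family e.
Proof.
elim: fuel rows s => [|fuel IH] rows s ex s0 /=; case: eqP => // rs.
- exact/known_graph_in_family/(explored_isomorphic ex).
- exact/known_graph_in_family/(explored_isomorphic ex).
have [|row [s' [rowP adm s's ex']]] := explored_step ex.
  by case: ex => _ ? _ _; lia.
move=> /allP/(_ _ rowP); rewrite adm -s's; apply: IH ex' _.
by rewrite s's; lia.
Qed.

Lemma no_twins_in_family : in_family e.
Proof.
have ex : explored [::] [:: x0] by split.
exact: (explore_in_family (s := [:: x0]) ex (erefl true) explore_true).
Qed.

End Exploration.

(** * Vertices with the same neighbours *)

(** Modulo 2 the products [s x z * s y z] are the indicators of the common neighbours, and they sum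
    to 0. *)
Lemma even_common (V : finType) (e : rel V) (s : V -> V -> int) x y :
  signing e s -> x != y -> ~~ odd (common e x y).
Proof.
move=> [_ sE ss] xy; have := ss x y; rewrite (negPf xy) mulr0n.
move=> /(congr1 (fun z : int => odd `|z|%N)).
rewrite (big_morph (fun z : int => odd `|z|%N) (id1 := false) (op1 := addb)) //.
  have -> : odd (common e x y) = \big[addb/false]_z odd `|(s x z * s y z)%R|%N.
    rewrite /common -sum1dep_card big_mkcond (big_morph odd oddD (erefl _)).
    by apply: eq_bigr => z _; rewrite abszM !sE; case: (e x z); case: (e y z).
  by move=> ->.
by move=> a b; lia.
Qed.

Section Neighbours.
Variables (V : finType) (e : rel V).
Hypotheses (e_sym : symmetric e) (e_irr : irreflexive e) (e4 : regular 4 e).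

Lemma eq_nbrs (x y : V) : (forall z, e x z -> e y z) -> e x =1 e y.
Proof.
move=> sub z; suff /setP/(_ z) : [set z | e x z] = [set z | e y z] by rewrite !inE.
apply/eqP; rewrite eqEcard; have := e4 x; have := e4 y; rewrite /degree => -> ->.
by rewrite leqnn andbT; apply/subsetP => t; rewrite !inE; apply: sub.
Qed.

Lemma common_eq_nbrs (x y : V) : 3 < common e x y -> e x =1 e y.
Proof.
rewrite /common => xy; apply: eq_nbrs => z xz.
suff /setP/(_ z) : [set z | e x z && e y z] = [set z | e x z].
  by rewrite !inE xz /= => ->.
apply/eqP; rewrite eqEcard; have := e4 x; rewrite /degree => ->.
by rewrite xy andbT; apply/subsetP => t; rewrite !inE => /andP[].
Qed.

End Neighbours.

Lemma card_gt2_set (T : finType) (A : {set T}) x y z :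
  x \in A -> y \in A -> z \in A -> uniq [:: x; y; z] -> 2 < #|A|.
Proof.
move=> xA yA zA /card_uniqP u; rewrite -[2 < _]/(size [:: x; y; z] <= _) -u.
by apply/subset_leq_card/subsetP => t; rewrite !inE => /or3P[] /eqP ->.
Qed.

Definition index_swap (i : nat) := if odd i then i.-1 else i.+1.

Lemma index_swapK : involutive index_swap.
Proof. by case=> [|i] //; rewrite /index_swap /=; case o: (odd i); rewrite //= o. Qed.

Lemma index_swap_neq i : index_swap i != i.
Proof. by rewrite /index_swap; case: ifP => ?; lia. Qed.

Lemma index_swap_lt i n : ~~ odd n -> i < n -> index_swap i < n.
Proof. by rewrite /index_swap; case: ifP; lia. Qed.

Section Twins.
Variables (V : finType) (e : rel V) (s : V -> V -> int).
Hypotheses (e_sym : symmetric e) (e_irr : irreflexive e)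
  (e_conn : forall x y, connect e x y) (e4 : regular 4 e) (es : signing e s).

(** For distinct vertices, parity turns three common neighbours into four, which is the whole
    neighbourhood. *)
Lemma common3_eq_nbrs (x y : V) : 2 < common e x y -> e x =1 e y.
Proof.
move=> xy; case: (eqVneq x y) => [-> // | nxy]; apply: (common_eq_nbrs e4).
by rewrite ltn_neqAle xy andbT; apply: contraNneq (even_common es nxy) => <-.
Qed.

(* Two of the four products s x b * s y b have each sign; if b has the same
   sign as a, then x and y cannot be the only common neighbours of a and b. *)
Lemma twin_nbr x y a : x != y -> e x =1 e y -> e x a ->
  exists b, [/\ b != a, e x b & e a =1 e b].
Proof.
have [sN sE ss] := es => xy exy xa.
pose g z : int := (s x z * s y z)%R.
have sgn z : e x z -> (s x z = 1 \/ s x z = -1)%R.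
  by move=> xz; have := sE x z; rewrite xz; lia.
have sgny z : e x z -> (s y z = 1 \/ s y z = -1)%R.
  by move=> xz; have := sE y z; rewrite -exy xz; lia.
have [b ba /andP[xb gab]] : exists2 b, b != a & e x b && (g b == g a).
  case: (boolP [exists (b | b != a), e x b && (g b == g a)]) => [/exists_inP // |].
  move=> /exists_inPn gN; exfalso.
  (* Otherwise [g] would be [g a] once and [- g a] three times, with nonzero sum. *)
  have := ss x y; rewrite (negPf xy) mulr0n (bigID (e x)) /= [X in (_ + X)%R]big1.
    rewrite addr0 (bigD1 a) //= (eq_bigr (fun=> (- g a)%R)) => [|z /andP[xz za]].
      rewrite sumr_const -/(g a).
      have -> : #|[pred z | e x z & z != a]| = 3.
        have := e4 x; rewrite /degree (cardsD1 a) inE xa => -[<-].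
        by apply: eq_card => z; rewrite !inE andbC.
      rewrite /g; have := sgn a xa; have := sgny a xa.
      by case=> -> [] ->.
    have := gN z za; rewrite xz /= /g.
    by have := sgn a xa; have := sgny a xa; have := sgn z xz; have := sgny z xz;
      do 4!case=> ->.
  move=> z nxz; suff -> : s x z = 0%R by rewrite mul0r.
  by have := sE x z; rewrite (negPf nxz); lia.
(* With only [x] and [y] in common, the rows of [a] and [b] would have a product of two terms, equal
   since [g a = g b], hence 2 or -2. *)
exists b; split=> //; apply: common3_eq_nbrs; rewrite ltnNge; apply/negP => le2.
have := ss a b; rewrite eq_sym (negPf ba) mulr0n (bigD1 x) //= (bigD1 y) 1?eq_sym //=.
rewrite big1 => [|z /andP[zx zy]].
  rewrite addr0 (sN a x) (sN b x) (sN a y) (sN b y) !mulrNN.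
  move: gab; rewrite /g.
  by have := sgn a xa; have := sgny a xa; have := sgn b xb; have := sgny b xb;
    do 4!case=> ->.
have : ~~ (e a z && e b z).
  apply: contraL le2 => abz; rewrite -ltnNge; apply: (@card_gt2_set _ _ x y z).
  - by rewrite inE e_sym xa e_sym.
  - by rewrite inE ![e _ y]e_sym -!exy xa.
  - by rewrite inE.
  by rewrite /= !inE negb_or xy ![_ == z]eq_sym zx zy.
have := sE a z; have := sE b z; case: (e a z); case: (e b z) => //= h h' _.
- by rewrite (_ : s b z = 0)%R ?mulr0 //; lia.
- by rewrite (_ : s a z = 0)%R ?mul0r //; lia.
by rewrite (_ : s b z = 0)%R ?mulr0 //; lia.
Qed.

Definition twins (x : V) : {set V} := [set y | [forall z, e x z == e y z]].

Lemma twinsP x y : reflect (e x =1 e y) (y \in twins x).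
Proof. by rewrite inE; apply: (iffP forallP) => exy z; apply/eqP. Qed.

Lemma eq_twins x y : y \in twins x -> twins x = twins y.
Proof.
move=> /twinsP exy; apply/setP => z.
by apply/twinsP/twinsP => h t; rewrite ?exy -?h -?exy.
Qed.

Lemma nbr_exists x : exists a, e x a.
Proof.
have : [set a | e x a] != set0 by rewrite -card_gt0; have := e4 x; rewrite /degree => ->.
by case/set0Pn => a; rewrite inE; exists a.
Qed.

Hypothesis has_twin : exists x y, x != y /\ e x =1 e y.

(** By [twin_nbr], having a twin passes to neighbours, hence to the whole connected graph. *)
Lemma twin_exists x : exists2 y, y != x & y \in twins x.
Proof.
apply/exists_inP; have [u [v [uv euv]]] := has_twin.
pose paired x := [exists (y | y != x), y \in twins x].
apply: (connected_invariant (s := paired) e_conn (x := u)).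
  by apply/exists_inP; exists v; [rewrite eq_sym | apply/twinsP].
move=> y z /exists_inP[y' yy' /twinsP eyy'] yz.
rewrite eq_sym in yy'; have [z' [? _ ?]] := twin_nbr yy' eyy' yz.
by apply/exists_inP; exists z' => //; apply/twinsP.
Qed.

(** A class lies in the neighbourhood of any neighbour [a] of [x], so an odd one would have three
    members. Then all neighbours of [x] share these three, hence all have the same neighbours, and
    the fourth neighbour of [a] would belong to the class too. *)
Lemma even_twins x : ~~ odd #|twins x|.
Proof.
have [a xa] := nbr_exists x.
have sub : twins x \subset [set z | e a z].
  by apply/subsetP => y /twinsP exy; rewrite inE e_sym -exy.
have le4 := subset_leq_card sub; have := e4 a; rewrite /degree => a4.
rewrite a4 in le4; apply/negP => odd_tw.
have [y yx yT] := twin_exists x.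
have xT : x \in twins x by apply/twinsP.
have tw3 : #|twins x| = 3.
  have : 1 < #|twins x|.
    by rewrite (cardsD1 x) xT (cardsD1 y) !inE yx; move: yT; rewrite inE => ->.
  by case: #|_| le4 odd_tw => [|[|[|[|[|]]]]].
have nbrs_eq b : e x b -> e a =1 e b.
  move=> xb; apply: common3_eq_nbrs; rewrite -tw3; apply/subset_leq_card/subsetP => z.
  by move=> /twinsP exz; rewrite inE ![e _ z]e_sym -!exz xa xb.
have [w aw wT] : exists2 w, e a w & w \notin twins x.
  have : [set z | e a z] :\: twins x != set0.
    by rewrite -card_gt0 cardsD (setIidPr sub) a4 tw3.
  by case/set0Pn => w; rewrite !inE => /andP[? ?]; exists w; rewrite ?inE.
case/negP: wT; apply/twinsP; apply: (eq_nbrs e4) => b xb.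
by rewrite e_sym -(nbrs_eq b xb).
Qed.

(* The classes of [twins] have an even number of elements, paired in the order
   of enumeration. *)
Definition twin (x : V) : V :=
  let c := enum (twins x) in nth x c (index_swap (index x c)).

Lemma twin_spec x : [/\ twin x != x, twin (twin x) = x & e (twin x) =1 e x].
Proof.
have xT : x \in enum (twins x) by rewrite mem_enum; apply/twinsP.
set c := enum (twins x) in xT; set i := index x c.
have uc : uniq c := enum_uniq _.
have lt_i : i < size c by rewrite index_mem.
have lt_j : index_swap i < size c by apply: index_swap_lt; rewrite // -cardE even_twins.
have tE : twin x = nth x c (index_swap i) by [].
have tT : twin x \in twins x by rewrite -mem_enum tE mem_nth.
split.
- by rewrite tE -[X in _ != X](nth_index x xT) nth_uniq // index_swap_neq.
(* Both twins enumerate the same class, so the second swap undoes the first; only the default of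
   [nth] differs. *)
- rewrite {1}/twin -(eq_twins tT) -/c tE index_uniq // index_swapK.
  by rewrite (set_nth_default x) ?nth_index.
by move=> z; have /twinsP -> := tT.
Qed.

End Twins.

(** * From a pairing of twins to a doubled cycle *)

Section Blowup.
Variables (V : finType) (e : rel V) (t : V -> V).
Hypotheses (e_sym : symmetric e) (e_irr : irreflexive e)
  (e_conn : forall x y, connect e x y) (e4 : regular 4 e).
Hypotheses (t_neq : forall x, t x != x) (tK : involutive t)
  (t_nbr : forall x, e (t x) =1 e x).

Definition same (x y : V) := (y == x) || (y == t x).

Lemma same_refl x : same x x.
Proof. by rewrite /same eqxx. Qed.

Lemma same_sym x y : same x y = same y x.
Proof. by rewrite /same eq_sym; congr (_ || _); apply/eqP/eqP => ->; rewrite tK. Qed.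

Lemma same_trans y x z : same x y -> same y z -> same x z.
Proof.
by rewrite /same => /orP[] /eqP -> /orP[] /eqP ->; rewrite ?tK eqxx ?orbT.
Qed.

Lemma same_nbr x y z : same x y -> e z x = e z y.
Proof. by case/orP=> /eqP -> //; rewrite ![e z _]e_sym t_nbr. Qed.

Lemma same_nbr_l x y z : same x y -> e x z = e y z.
Proof. by rewrite ![e _ z]e_sym; apply: same_nbr. Qed.

Lemma nbr_not_same x y : e x y -> ~~ same x y.
Proof. by move=> xy; apply/negP => sxy; have := same_nbr_l y sxy; rewrite xy e_irr. Qed.

(** The vertices [q], [t q], [r], [t r] are four distinct neighbours, hence all of them. *)
Lemma nbrs_same x q r : e x q -> e x r -> ~~ same q r ->
  forall v, e x v = same q v || same r v.
Proof.
move=> xq xr nqr v.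
suff /setP/(_ v) : [set q; t q; r; t r] = [set v | e x v].
  by rewrite !inE /same !orbA => <-.
have e_t y : e x y -> e x (t y) by rewrite ![e x _]e_sym t_nbr.
apply/eqP; rewrite eqEcard; have := e4 x; rewrite /degree => ->; apply/andP; split.
  by apply/subsetP => y; rewrite !inE => /orP[/orP[/orP[]|]|] /eqP ->; rewrite ?e_t.
have /card_uniqP E : uniq [:: q; t q; r; t r].
  have nsr : ~~ same r q by rewrite same_sym.
  move: nqr nsr; rewrite /same !negb_or => /andP[rq rtq] /andP[qr qtr].
  rewrite /= !inE !negb_or [q == t q]eq_sym [r == t r]eq_sym !t_neq.
  rewrite eq_sym rq qtr [t q == r]eq_sym rtq (inj_eq (can_inj tK)) eq_sym rq.
  by [].
rewrite -[4]/(size [:: q; t q; r; t r]) -E; apply/eq_leq/eq_card => y.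
by rewrite !inE !orbA.
Qed.

Lemma nbr_not_same_exists p q : exists r, e q r && ~~ same p r.
Proof.
have : ~~ ([set r | e q r] \subset [set p; t p]).
  apply/negP => /subset_leq_card; have := e4 q; rewrite /degree => ->.
  by rewrite cards2; case: (_ != _).
case/subsetPn => r; rewrite !inE => qr npr; exists r.
by rewrite qr.
Qed.

Definition next_vertex p q := xchoose (nbr_not_same_exists p q).

Variables x0 x1 : V.
Hypothesis e01 : e x0 x1.

(** A walk on pairs that never turns back; the iterated state holds two consecutive vertices. *)
Definition walk (n : nat) : V :=
  (iter n (fun pq => (pq.2, next_vertex pq.1 pq.2)) (x0, x1)).1.

Lemma walk_edge n : e (walk n) (walk n.+1).
Proof.
case: n => [|n]; first exact: e01.
by have /andP[] := xchooseP (nbr_not_same_exists (walk n) (walk n.+1)).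
Qed.

Lemma walk_turn n : ~~ same (walk n) (walk n.+2).
Proof. by have /andP[] := xchooseP (nbr_not_same_exists (walk n) (walk n.+1)). Qed.

(** Take the first [m] at which a pair is repeated, which exists by the pigeonhole principle. The
    repeated pair must be the initial one: a later pair already has both its neighbouring pairs on
    the walk, so the pair before [m] would be an earlier repetition. *)
Lemma walk_returns : exists m, [/\ 2 < m, same (walk 0) (walk m)
  & forall i j, i < j < m -> ~~ same (walk i) (walk j)].
Proof.
pose P m := [exists i : 'I_m, same (walk i) (walk m)].
have exP : exists m, P m.
  have : ~~ injectiveb (fun i : 'I_#|V|.+1 => walk i).
    by apply/negP => /injectiveP/leq_card; rewrite card_ord ltnn.
  case/injectivePn => i [j ij wij].
  have [lt_ij | lt_ji | /ord_inj eq_ij] := ltngtP i j.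
  - by exists j; apply/existsP; exists (Ordinal lt_ij); rewrite /= wij same_refl.
  - by exists i; apply/existsP; exists (Ordinal lt_ji); rewrite /= wij same_refl.
  by rewrite eq_ij eqxx in ij.
case: (ex_minnP exP) => m /existsP[[i lt_im] /= wim] m_min; exists m.
have inj k l : k < l < m -> ~~ same (walk k) (walk l).
  case/andP=> lt_kl lt_lm; apply/negP => w_kl.
  have /m_min : P l by apply/existsP; exists (Ordinal lt_kl).
  by rewrite leqNgt lt_lm.
have adj k : ~~ same (walk k) (walk k.+1) := nbr_not_same (walk_edge k).
(* One or two steps of the walk always lead to another pair. *)
have i_lt : i.+2 < m.
  case: (ltngtP i.+2 m) => // [|E]; last by rewrite -E (negPf (walk_turn i)) in wim.
  rewrite ltnS leq_eqVlt => /orP[/eqP E | ]; last by lia.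
  by rewrite E (negPf (adj i)) in wim.
case: i => [|i] in lt_im wim i_lt *; first by split.
have [m' Em] : exists m', m = m'.+1 by exists m.-1; lia.
have : e (walk i.+1) (walk m').
  by rewrite (same_nbr_l _ wim) Em e_sym walk_edge.
rewrite (@nbrs_same _ (walk i) (walk i.+2)) ?walk_edge ?walk_turn 1?e_sym ?walk_edge //.
case/orP=> wi; exfalso.
  by case/negP: (inj i m' ltac:(lia)).
case: (ltngtP i.+2 m') => [lt_i | lt_i | E].
- by case/negP: (inj i.+2 m' ltac:(lia)).
- by lia.
by lia.
Qed.

(** Along the closed walk each pair has exactly the previous and the next pair as neighbours, so the
    pairs met are closed under adjacency and exhaust the connected graph. *)
Lemma walk_cycle_blowup : exists2 m, 2 < m & isomorphic e (@cycle_blowup m).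
Proof.
have [m [m2 wm inj]] := walk_returns; exists m => //.
have inj' (k l : 'I_m) : same (walk k) (walk l) = (k == l).
  apply/idP/eqP => [w_kl | ->]; last exact: same_refl.
  apply/eqP/contraT; rewrite -val_eqE neq_ltn => /orP[] lt.
    by have := inj k l; rewrite lt ltn_ord w_kl => /(_ isT).
  by have := inj l k; rewrite lt ltn_ord same_sym w_kl => /(_ isT).
have succ (k : 'I_m) : e (walk k) (walk (ordS k)).
  have /= := ltn_ord k; rewrite leq_eqVlt => /orP[/eqP E | lt].
    by have := walk_edge k; rewrite /= E modnn (same_nbr _ wm).
  by rewrite /= modn_small // walk_edge.
have pred (k : 'I_m) : e (walk k) (walk (ord_pred k)).
  by rewrite e_sym -{2}(ord_predK k) succ.
have nbr (k : 'I_m) v : e (walk k) v =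
    same (walk (ordS k)) v || same (walk (ord_pred k)) v.
  (* The next and the previous pair differ because [m] exceeds 2. *)
  apply: nbrs_same; [exact: succ | exact: pred |]; rewrite inj'; apply/negP => /eqP E.
  by case/negP: (ordS_asym k (ordS k) m2); rewrite {3}E ord_predK !eqxx.
pose f (x : 'I_m * bool) := if x.2 then t (walk x.1) else walk x.1.
have fw (x : 'I_m * bool) : same (walk x.1) (f x).
  by rewrite /f /same; case: x.2; rewrite eqxx ?orbT.
have f_inj : injective f.
  move=> [k b] [l c] E.
  have kl : k = l.
    apply/eqP; rewrite -inj'; apply: same_trans (fw (k, b)) _.
    by rewrite E same_sym; exact: (fw (l, c)).
  move: E; rewrite /f kl /=; case: b; case: c => // E; have := t_neq (walk l).
    by rewrite E eqxx.
  by rewrite -E eqxx.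
have f_surj v : v \in codom f.
  apply: (connected_invariant e_conn (x := walk 0) (s := fun v => v \in codom f)).
    have m0 : 0 < m by lia.
    by apply/codomP; exists (Ordinal m0, false).
  move=> y z /codomP[x ->]; rewrite -(same_nbr_l _ (fw x)) nbr.
  have in_f k : same (walk k) z -> k < m -> z \in codom f.
    move=> /orP[] /eqP -> km; apply/codomP.
      by exists (Ordinal km, false).
    by exists (Ordinal km, true).
  by case/orP=> /in_f; apply; apply: ltn_ord.
apply/isomorphic_sym/(inj_isomorphic f_inj).
  by rewrite -(card_codom f_inj); apply: eq_card => v; rewrite f_surj.
move=> x y; rewrite -(same_nbr_l _ (fw x)) -(same_nbr _ (fw y)) nbr !inj'.
rewrite /cycle_blowup eq_sym; congr (_ || _).
by rewrite -{1}(ordSK y.1) (inj_eq (can_inj (@ord_predK _))).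
Qed.

End Blowup.

Lemma signable_iff_in_family n (e : rel 'I_n) :
  symmetric e -> irreflexive e -> connected_graph e -> regular 4 e ->
  signable e <-> in_family e.
Proof.
move=> e_sym e_irr [n0 e_conn] e4; split; last exact: signable_in_family.
case=> s es; case/card_gt0P: n0 => x0 _.
case: (boolP [exists x, [exists y, (x != y) && [forall z, e x z == e y z]]]) => [tw | no_tw].
  have has_tw : exists x y, x != y /\ e x =1 e y.
    case/existsP: tw => x /existsP[y /andP[xy /forallP exy]].
    by exists x, y; split=> // z; apply/eqP.
  have tS := twin_spec e_sym e_conn e4 es has_tw.
  have [x1 e01] := nbr_exists e4 x0.
  have [||| m m2 em] := @walk_cycle_blowup _ e (twin e) e_sym e_irr e_conn e4 _ _ _ x0 x1 e01.
  - by move=> x; have [] := tS x.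
  - by move=> x; have [] := tS x.
  - by move=> x; have [] := tS x.
  exact: in_family_cycle_blowup m2 em.
apply: no_twins_in_family => // x y xy.
(* Four common neighbours would make [x] and [y] twins; evenness then leaves 0 and 2. *)
have not4 : ~~ (3 < common e x y).
  apply: contra no_tw => /(common_eq_nbrs e4) exy.
  apply/existsP; exists x; apply/existsP; exists y; rewrite xy.
  by apply/forallP => z; rewrite exy.
have := even_common es xy; move: (common e x y) not4.
by case=> [|[|[|[|k]]]].
Qed.

Theorem theorem3p7 (n : nat) (e : rel 'I_n)
    (e_sym : symmetric e) (e_irr : irreflexive e)
    (e_conn : connected_graph e) (e_reg : regular 4 e) :
  (exists o : rel 'I_n, orientation e o /\ optimum_skew_energy e o)
  <-> in_family e.
Proof.
exact: iff_trans (optimum_signable e_reg)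
  (signable_iff_in_family e_sym e_irr e_conn e_reg).
Qed.
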